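(* For every integer $k\ge 1$ there is a constant $c_k$ and a family of graphs $(U_n)_{n\ge 1}$ such that for every $n\ge 2$, $U_n$ has treewidth at most $3k-1$, has at most $n^{c_k}$ vertices, and contains every $n$-vertex graph of treewidth at most $k$ as an induced subgraph.
   Context: ''$U$ contains $H$ as an induced subgraph'' means $U$ has an induced subgraph isomorphic to $H$. Treewidth is the usual notion: the minimum, over tree-decompositions, of the maximum bag size minus one. The paper phrases this as: the class of graphs of treewidth at most $k$ has induced-universal graphs with treewidth $3k-1$ and order $n\mapsto n^{O_k(1)}$. *)

(* Defs.v *)
From mathcomp Require Import all_boot.
From mathcomp Require Import boolp.

Set Implicit Arguments.
Unset Strict Implicit.
Unset Printing Implicit Defensive.

Record sgraph := SGraph {
  vertex :> finType;
  adj : rel vertex;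
  adj_sym : symmetric adj;
  adj_irrefl : irreflexive adj }.

Definition isomorphic (G H : sgraph) : Prop :=
  exists f : G -> H, bijective f /\ {mono f : x y / adj x y}.

Section Induced.
Variables (G : sgraph) (S : {set G}).

Definition induced_vertex : finType := {x : G | x \in S}.
Definition induced_adj : rel induced_vertex := relpre val (@adj G).

Lemma induced_adj_sym : symmetric induced_adj.
Proof. by move=> x y; apply: adj_sym. Qed.

Lemma induced_adj_irrefl : irreflexive induced_adj.
Proof. by move=> x; apply: adj_irrefl. Qed.

Definition induced : sgraph := SGraph induced_adj_sym induced_adj_irrefl.

End Induced.

Definition contains_induced (U H : sgraph) : Prop :=
  exists S : {set U}, isomorphic (induced S) H.

Definition connected (G : sgraph) : Prop := forall x y : G, connect (@adj G) x y.

(* A [ucycle] of size 1 is excluded by irreflexivity, while one of size 2 is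
   just an edge traversed back and forth, so cycles are those of size >= 3. *)
Definition acyclic (G : sgraph) : Prop :=
  forall c : seq G, ucycle (@adj G) c -> size c < 3.

Definition is_tree (G : sgraph) : Prop :=
  [/\ 0 < #|G|, connected G & acyclic G].

Record tree_decomposition (G : sgraph) := TreeDecomposition {
  td_tree : sgraph;
  td_bag : td_tree -> {set G};
  td_treeP : is_tree td_tree;
  td_vertexP : forall v : G, exists t, v \in td_bag t;
  td_edgeP : forall u v : G, adj u v ->
    exists t, u \in td_bag t /\ v \in td_bag t;
  td_connectedP : forall v : G, connected (induced [set t | v \in td_bag t]) }.

(* The subtraction is truncated: the graph without vertices gets width 0
   rather than -1. *)
Definition width (G : sgraph) (D : tree_decomposition G) : nat :=
  (\max_(t : td_tree D) #|td_bag t|).-1.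

Section TrivialDecomposition.
Variable G : sgraph.

Definition point_graph : sgraph :=
  @SGraph unit (fun _ _ => false) (fun _ _ => erefl) (fun _ => erefl).

Lemma point_graph_tree : is_tree point_graph.
Proof.
split; first by rewrite card_unit.
  by case=> -[]; apply: connect0.
by move=> c /andP[_ /card_uniqP <-]; apply: leq_ltn_trans (max_card _) _;
   rewrite card_unit.
Qed.

Lemma trivial_connected (v : G) :
  connected (induced [set t : point_graph | v \in [set: G]]).
Proof.
move=> x y; suff -> : x = y by apply: connect0.
by apply: val_inj; case: (val x); case: (val y).
Qed.

Definition trivial_decomposition : tree_decomposition G :=
  @TreeDecomposition G point_graph (fun=> [set: G]) point_graph_tree
    (fun v => ex_intro _ tt (in_setT v))
    (fun u v _ => ex_intro _ tt (conj (in_setT u) (in_setT v)))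
    trivial_connected.

End TrivialDecomposition.

Lemma width_exists (G : sgraph) :
  exists w, `[< exists D : tree_decomposition G, width D = w >].
Proof.
by exists (width (trivial_decomposition G)); apply/asboolP;
   exists (trivial_decomposition G).
Qed.

Definition treewidth (G : sgraph) : nat := ex_minn (width_exists G).

(* Main.v *)
(* Words over a fixed alphabet, each of whose letters introduces one vertex with
   one of 3k colors and joins it to the most recent earlier vertices of some
   other colors, form a graph of treewidth at most 3k - 1, since at each word
   only the most recent vertex of each color matters.  Words of length O(log n)
   number n^O(1), so it suffices to build any n-vertex graph H of treewidth at
   most k by such a branching process of logarithmic depth, where at most 3k
   vertices of H are active at a time.

   For this, H is arranged in a rooted forest in which the subtree of each
   vertex v is attached to the rest through a set B v of at most k ancestors of
   v.  The pieces that occur are unions of full subtrees, attached to at most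
   k + 1 vertices, and subtrees of some a from which the subtree of some b was
   removed, attached to the at most 2k vertices of B a and B b.  Cutting a piece
   at a well-chosen third vertex f adds only B f, and halves the size within
   O(k) levels. *)

Require Import Defs.
From mathcomp Require Import all_boot zify boolp.

Set Implicit Arguments.
Unset Strict Implicit.
Unset Printing Implicit Defensive.

(** * Words *)

Section Words.
Variable w : nat.

(* Words grow at the head, so that the tail of a word is its parent.  The letter
   [inl b] only chooses a branch; [inr (c, A)] introduces a vertex of color [c],
   joined for every [i != c] in [A] to the latest vertex of color [i], which is
   identified with the suffix [look q i] at which it was introduced. *)
Definition letter : finType := (bool + 'I_w * {set 'I_w})%type.
Implicit Types (p q s : seq letter) (i c : 'I_w).

Fixpoint look q i : option (seq letter) :=
  match q with
  | [::] => None
  | inl _ :: q' => look q' i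
  | inr (c, _) :: q' => if c == i then Some q else look q' i
  end.

Definition introducing q := if q is inr _ :: _ then true else false.

(** The predicate [P] lets [back] ask for a resolved reference and [outer] for one left open to a
    later suffix. *)
Definition refers (P : option (seq letter) -> bool) q i :=
  if q is inr (c, A) :: q' then [&& i != c, i \in A & P (look q' i)] else false.

Definition back p q := [exists i, refers (pred1 (Some p)) q i].
Definition outer q i := refers (pred1 None) q i.

Lemma look_suffix q i (z : seq letter) : look q i = Some z ->
  introducing z /\ exists s, q = s ++ z.
Proof.
elim: q => //= -[b|[c A]] q IH.
  by move=> /IH[? [s ->]]; split=> //; exists (inl b :: s).
case: eqP => [_ [<-]|_ /IH[? [s ->]]]; first by split=> //; exists [::].
by split=> //; exists (inr (c, A) :: s).
Qed.

Lemma look_cat q s i :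
  look (q ++ s) i = if look q i is Some z then Some (z ++ s) else look s i.
Proof. by elim: q => // -[b|[c A]] q IH /=; rewrite IH //; case: ifP. Qed.

Lemma back_suffix p q : back p q -> size p < size q /\ exists s, q = s ++ p.
Proof.
case/existsP=> i; case: q => // -[//|[c A]] q /= /and3P[_ _ /eqP].
case/look_suffix=> _ [s ->]; split; first by rewrite size_cat; lia.
by exists (inr (c, A) :: s).
Qed.

Lemma introducing_cat q s : introducing q -> introducing (q ++ s).
Proof. by case: q. Qed.

(** A reference resolved inside [q] is merely extended by [s], while one resolved in [s] is too
    short to be [p ++ s], as [p] is nonempty. *)
Lemma back_cat p q s : introducing p -> introducing q ->
  back (p ++ s) (q ++ s) = back p q.
Proof.
case: q => // -[//|[c A]] q pI _; apply: eq_existsb => i /=.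
congr [&& _, _ & _]; rewrite look_cat; case: (look q i) => [z|] /=.
  rewrite !(inj_eq (@Some_inj _)); apply/eqP/eqP => [|->] // E.
  have := congr1 (fun t => take (size t - size s) t) E.
  by rewrite /= !size_cat !addnK !take_size_cat.
apply/eqP => /look_suffix[_ [t]] /(congr1 size); rewrite !size_cat.
by case: p pI => //= *; lia.
Qed.

Lemma outer_cat q l i : introducing q ->
  outer (q ++ [:: l]) i = outer q i && (if l is inr (c, _) then c != i else true).
Proof.
case: q => // -[//|[c A]] q _; rewrite /outer /=.
rewrite look_cat; case: (look q i) => [z|] /=; first by rewrite !andbF.
by case: l => [b|[c' A']] /=; rewrite ?andbT //; case: (c' == i); rewrite /= ?andbF ?andbT.
Qed.

Lemma back_root q c A : introducing q ->
  back [:: inr (c, A)] (q ++ [:: inr (c, A)]) = outer q c.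
Proof.
case: q => // -[//|[c' A']] q _; rewrite /outer /back /=.
apply/existsP/idP => [[i]|/and3P[H1 H2 /eqP H3]]; last first.
  by exists c; rewrite H1 H2 look_cat H3 /= eqxx.
case/and3P=> H1 H2; rewrite look_cat /=.
case E: (look q i) => [z|] /eqP; last first.
  by case: eqP => // -> _; rewrite H1 H2 E.
case/look_suffix: E => + _; case: z => // ? z _ [] _.
by move/(congr1 size); rewrite size_cat /=; lia.
Qed.

Lemma back_rootF q l : introducing q -> back (q ++ [:: l]) [:: l] = false.
Proof.
by move=> qI; apply/idP => /back_suffix[]; rewrite size_cat; case: q qI => //= *; lia.
Qed.

Lemma back_branchF p q b b' : b != b' ->
  back (p ++ [:: inl b]) (q ++ [:: inl b']) = false.
Proof.
move=> /eqP bb'; apply/idP => /back_suffix[_ [s]].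
rewrite catA => /(congr1 (last (inl b))); rewrite !last_cat /= => -[].
by move/esym.
Qed.

(** * Embedding a graph by introducing and branching *)

Section Embedding.
Variable H : sgraph.
Implicit Types (Z V S : {set H}).

(* [Z] is the set of active vertices, already introduced with colors [col] at a
   common suffix of all words, which [f] omits.  The last clause says that the
   colors left unresolved by [f v] are those of the neighbors of [v] in [Z]. *)
Definition embedding d (col : H -> 'I_w) Z V (f : H -> seq letter) : Prop :=
  [/\ forall v, v \in V -> introducing (f v) && (size (f v) <= d),
      {in V &, injective f},
      {in V &, forall u v, adj u v = back (f u) (f v) || back (f v) (f u)}
    & forall v i, v \in V ->
        outer (f v) i = [exists x in Z, (col x == i) && adj x v]].

(** Quantifying over all colorings allows a piece to be placed under any suffix that has introduced
    [Z], whatever colors were chosen there. *)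
Definition embeds d Z V : Prop :=
  forall col : H -> 'I_w, {in Z &, injective col} ->
  exists f, embedding d col Z V f.

Lemma embeds0 d Z : embeds d Z set0.
Proof. by move=> col _; exists (fun=> [::]); split=> [v|u v|u v|v i]; rewrite inE. Qed.

Lemma embeds_leq d d' Z V : d <= d' -> embeds d Z V -> embeds d' Z V.
Proof.
move=> dd' E col /E[f [f1 f2 f3 f4]]; exists f; split=> // v /f1.
by case/andP=> -> /leq_trans; apply.
Qed.

(** Active vertices without neighbors in [V] may be forgotten, which frees their colors. *)
Lemma embeds_mono d Z Z' V V' : Z' \subset Z -> V \subset V' ->
    (forall x v, x \in Z -> v \in V -> adj x v -> x \in Z') ->
  embeds d Z' V' -> embeds d Z V.
Proof.
move=> /subsetP sZ /subsetP sV ZV E col colI; have [|f [f1 f2 f3 f4]] := E col.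
  by move=> x y /sZ xZ /sZ; apply: colI.
exists f; split=> [v /sV/f1|u v /sV uV /sV|u v /sV uV /sV|v i vV] //.
- exact: f2.
- exact: f3.
rewrite f4 ?sV //; apply: eq_existsb => x.
apply/and3P/and3P => -[H1 H2 H3]; split=> //; first exact: sZ.
exact: ZV H3.
Qed.

(** Different branch letters at the ends of the words prevent any word of one part from being a
    suffix of a word of the other. *)
Lemma embeds_split d Z V V1 : V1 \subset V ->
    (forall u v, u \in V1 -> v \in V :\: V1 -> ~~ adj u v) ->
  embeds d Z V1 -> embeds d Z (V :\: V1) -> embeds d.+1 Z V.
Proof.
move=> sV1 noadj E1 E2 col colI.
have [f [f1 f2 f3 f4]] := E1 col colI; have [g [g1 g2 g3 g4]] := E2 col colI.
exists (fun v => if v \in V1 then f v ++ [:: inl true] else g v ++ [:: inl false]).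
have inV2 v : v \in V -> (v \in V1) = false -> v \in V :\: V1.
  by move=> vV v1; rewrite inE v1.
have cancel s t (l : letter) : s ++ [:: l] = t ++ [:: l] -> s = t.
  by rewrite !cats1 => /rcons_inj[].
have clash s t b b' : b != b' -> s ++ [:: inl b : letter] <> t ++ [:: inl b'].
  by move=> /eqP bb'; rewrite !cats1 => /rcons_inj[_ /bb'].
split=> [v vV|u v uV vV|u v uV vV|v i vV].
- case: ifP => v1; first by have /andP[? ?] := f1 v v1;
    rewrite introducing_cat // size_cat addn1.
  by have /andP[? ?] := g1 v (inV2 _ vV v1); rewrite introducing_cat // size_cat addn1.
- case: ifP => u1; case: ifP => v1.
  + by move/cancel/f2 => ->.
  + by move/clash => [].
  + by move/clash => [].
  + by move/cancel/g2 => -> //; apply: inV2.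
- case: ifP => u1; case: ifP => v1.
  + have /andP[? _] := f1 u u1; have /andP[? _] := f1 v v1.
    by rewrite !back_cat // f3.
  + by rewrite !back_branchF //; apply/negbTE/noadj => //; apply: inV2.
  + by rewrite !back_branchF // adj_sym; apply/negbTE/noadj => //; apply: inV2.
  + have u2 := inV2 _ uV u1; have v2 := inV2 _ vV v1.
    have /andP[? _] := g1 u u2; have /andP[? _] := g1 v v2.
    by rewrite !back_cat // g3.
- case: ifP => v1; first by have /andP[? _] := f1 v v1; rewrite outer_cat // andbT f4.
  have v2 := inV2 _ vV v1.
  by have /andP[? _] := g1 v v2; rewrite outer_cat // andbT g4.
Qed.

(** Fewer than [w] colors are in use, so [v] gets a free one. It becomes a one-letter word, and its
    letter is appended to all other words, where it resolves the open references to its color. *)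
Lemma embeds_intro1 d Z V v : v \in V -> v \notin Z -> #|Z| < w ->
  embeds d (v |: Z) (V :\ v) -> embeds d.+1 Z V.
Proof.
move=> vV vZ cZ E col colI.
have [c cF] : exists c, c \notin col @: Z.
  have : #|col @: Z| < #|'I_w|.
    by rewrite card_ord; apply: leq_ltn_trans (leq_imset_card _ _) cZ.
  rewrite -(cardsC (col @: Z)) -[X in X < _]addn0 ltn_add2l => /card_gt0P[c].
  by rewrite inE; exists c.
have colZ x : x \in Z -> col x != c.
  by move=> xZ; apply: contraNneq cF => <-; apply: imset_f.
pose col' x := if x == v then c else col x.
have col'Z x : x \in Z -> col' x = col x.
  by rewrite /col'; case: eqP vZ => // -> /negP.
have col'v : col' v = c by rewrite /col' eqxx.
have [|f [f1 f2 f3 f4]] := E col'.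
  move=> x y; rewrite !in_setU1 => /orP[/eqP->|xZ] /orP[/eqP->|yZ] //.
  - by rewrite col'v col'Z // => /esym/eqP; rewrite (negbTE (colZ _ yZ)).
  - by rewrite col'v col'Z // => /eqP; rewrite (negbTE (colZ _ xZ)).
  - by rewrite !col'Z //; apply: colI.
pose A := [set i | [exists x in Z, (col x == i) && adj x v]].
pose l : letter := inr (c, A).
have cA : c \notin A.
  by rewrite inE; apply/existsP => -[x /and3P[/colZ/negbTE->]].
exists (fun u => if u == v then [:: l] else f u ++ [:: l]).
have inV u : u \in V -> (u == v) = false -> u \in V :\ v.
  by move=> uV uv; rewrite !inE uv.
have fI u : u \in V -> (u == v) = false -> introducing (f u).
  by move=> uV /(inV _ uV)/f1/andP[].
have f_root u : u \in V -> (u == v) = false -> [:: l] <> f u ++ [:: l].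
  move=> uV /(fI _ uV); case: (f u) => // ? t _ [_] /(congr1 size).
  by rewrite size_cat /=; lia.
have out u : u \in V -> (u == v) = false -> outer (f u) c = adj v u.
  move=> uV uv; rewrite f4 ?inV //; apply/existsP/idP.
    move=> [x] /and3P[]; rewrite in_setU1 => /orP[/eqP->//|xZ].
    by rewrite col'Z // (negbTE (colZ _ xZ)).
  by move=> vu; exists v; rewrite in_setU1 eqxx col'v eqxx.
split=> [u uV|u u' uV u'V|u u' uV u'V|u i uV].
- case: ifP => // uv; have /andP[? ?] := f1 u (inV _ uV uv).
  by rewrite introducing_cat // size_cat addn1.
- case: ifP => [/eqP->|uv]; case: ifP => [/eqP->//|uv'].
  + by move/f_root => []. 
  + by move/esym/f_root => [].
  by rewrite !cats1 => /rcons_inj[/f2->] //; apply: inV.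
- case: ifP => [/eqP->|uv]; case: ifP => [/eqP->|uv'].
  + rewrite adj_irrefl; apply/esym/negbTE; rewrite negb_or andbb.
    by apply/negP => /back_suffix[]; rewrite ltnn.
  + by rewrite back_root ?back_rootF ?orbF ?out ?fI.
  + by rewrite back_root ?back_rootF ?out ?fI // adj_sym.
  + by rewrite !back_cat ?fI // f3 ?inV.
- case: ifP => [/eqP->|uv].
    rewrite /outer /= andbT [in LHS]inE; case: eqP => [->|] //=.
    by move: cA; rewrite inE => /negbTE.
  rewrite outer_cat ?fI //= f4 ?inV //; apply/andP/existsP.
    move=> [/existsP[x /and3P[]]]; rewrite in_setU1 => /orP[/eqP->|xZ].
      by rewrite col'v => ->.
    by rewrite col'Z // => ? ? _; exists x; apply/and3P.
  move=> [x /and3P[xZ /eqP <- xu]]; split; last by rewrite eq_sym colZ.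
  by apply/existsP; exists x; rewrite in_setU1 xZ orbT col'Z // eqxx.
Qed.

Lemma embeds_intro d Z V S : S \subset V -> [disjoint Z & V] -> #|Z :|: S| <= w ->
  embeds d (Z :|: S) (V :\: S) -> embeds (d + #|S|) Z V.
Proof.
have [n] := ubnP #|S|; elim: n S d => // n IH S d /ltnSE Sn SV ZV cS E.
have [S0|[v vS]] := set_0Vmem S.
  by move: E; rewrite S0 setU0 setD0 cards0 addn0.
have vV := subsetP SV _ vS; have vZ : v \notin Z by rewrite (disjointFl ZV).
have cSv : #|S| = #|S :\ v|.+1 by rewrite (cardsD1 v S) vS.
rewrite cSv addnS -addSn; apply: IH.
- by rewrite -cSv.
- exact: subset_trans (subD1set _ _) SV.
- exact: ZV.
- by apply: leq_trans cS; apply: subset_leq_card; rewrite setUS // subD1set.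
apply: (@embeds_intro1 _ _ _ v).
- by rewrite !inE eqxx vV.
- by rewrite !inE eqxx orbF.
- apply: leq_trans cS; apply: proper_card; apply/properP; split.
    by rewrite setUS // subD1set.
  by exists v; rewrite !inE ?vS ?orbT // eqxx orbF.
have -> : v |: (Z :|: S :\ v) = Z :|: S by rewrite setUCA setD1K.
suff -> : (V :\: (S :\ v)) :\ v = V :\: S by [].
by apply/setP => x; rewrite !inE; case: eqP => [->|] //=; rewrite vS.
Qed.

End Embedding.
End Words.

(** * The universal graph *)

Section ParentTree.
Variables (T : finType) (parent : T -> T) (root : T) (height : T -> nat).
Hypothesis height_parent : forall x, x != root -> height (parent x) < height x.

Definition parent_adj : rel T := fun x y =>
  ((x != root) && (parent x == y)) || ((y != root) && (parent y == x)).

Lemma parent_adj_sym : symmetric parent_adj.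
Proof. by move=> x y; rewrite /parent_adj orbC. Qed.

Lemma parent_adj_irrefl : irreflexive parent_adj.
Proof.
move=> x; rewrite /parent_adj orbb; apply/andP => -[/height_parent + /eqP E].
by rewrite E ltnn.
Qed.

Definition parent_graph : sgraph := SGraph parent_adj_sym parent_adj_irrefl.

(** Every vertex climbs to [root]. On a cycle, both neighbors of a vertex of maximal height must be
    its parent, which rules out three or more vertices. *)
Lemma parent_graph_tree : is_tree parent_graph.
Proof.
have toroot (x : parent_graph) : connect (@adj parent_graph) x root.
  have [n] := ubnP (height x); elim: n x => // n IH x /ltnSE xn.
  have [->|xr] := eqVneq x root; first exact: connect0.
  have px := height_parent xr.
  apply: (@connect_trans _ _ (parent x)); last exact: IH (leq_trans px xn).
  by apply: connect1; rewrite /= /parent_adj xr eqxx.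
split; first by apply/card_gt0P; exists root.
  move=> x y; apply: connect_trans (toroot x) _.
  by rewrite (@sym_connect_sym _ _ (@adj_sym parent_graph)); apply: toroot.
case=> [|x0 c0] // /andP[]; set c := x0 :: c0 => cyc cU.
have [x xc xmax] : exists2 x, x \in c & forall y, y \in c -> height y <= height x.
  have := @arg_maxnP _ x0 (fun x => x \in c) height (mem_head _ _).
  by case=> x xc xmax; exists x.
have up y : y \in c -> adj (s := parent_graph) x y -> y = parent x.
  move=> yc; rewrite /adj /= /parent_adj => /orP[/andP[_ /eqP//]|].
  case/andP=> /height_parent + /eqP E.
  by rewrite E ltnNge xmax.
have nx : next c x = parent x.
  by apply: up; [rewrite mem_next|apply: next_cycle].
have pv : prev c x = parent x.
  by apply: up; [rewrite mem_prev|rewrite adj_sym; apply: prev_cycle].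
rewrite ltnNge; apply/negP => c3.
have [i c' rc] := rot_to xc.
have U' : uniq (x :: c') by rewrite -rc rot_uniq.
have := next_prev cU x; rewrite pv -nx -!(next_rot i cU) rc.
case: c' U' rc => [|y [|z c']] U' rc;
  try by move/(congr1 size): rc c3; rewrite size_rot => ->.
move: U'; rewrite /= !inE eqxx !negb_or => /andP[/and3P[xy xz _] _].
by rewrite eqxx eq_sym (negbTE xy) => /eqP; rewrite eq_sym (negbTE xz).
Qed.

End ParentTree.

Lemma treewidth_leq (G : sgraph) (D : tree_decomposition G) m :
  (forall t, #|td_bag (t := D) t| <= m.+1) -> treewidth G <= m.
Proof.
move=> Dm; rewrite /treewidth; case: ex_minnP => w _ /(_ (width D)) wmin.
apply: leq_trans (wmin _) _; first by apply/asboolP; exists D.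
by rewrite /width -subn1 leq_subLR add1n; apply/bigmax_leqP => t _; apply: Dm.
Qed.

(** * The graph on words of bounded length and its tree-decomposition *)

Section UniversalGraph.
Variables (w d : nat).
Let node : finType := d.-bseq (letter w).

Definition universal_vertex : finType := {q : node | introducing q}.
Definition universal_adj : rel universal_vertex :=
  fun p q => back (val p) (val q) || back (val q) (val p).

Lemma universal_adj_sym : symmetric universal_adj.
Proof. by move=> p q; rewrite /universal_adj orbC. Qed.

Lemma universal_adj_irrefl : irreflexive universal_adj.
Proof.
by move=> p; apply/negbTE; rewrite negb_or andbb; apply/negP => /back_suffix[];
   rewrite ltnn.
Qed.

Definition universal : sgraph := SGraph universal_adj_sym universal_adj_irrefl.

(** The default of [insub_bseq] is never reached, as [behead] does not lengthen a word. *)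
Definition word_parent (q : node) : node := insub_bseq d (behead q).

Lemma word_parentE (q : node) : word_parent q = behead q :> seq (letter w).
Proof.
rewrite /word_parent /insub_bseq insubdK // -topredE /= size_behead.
by apply: leq_trans (leq_pred _) (size_bseq q).
Qed.

Lemma size_word_parent (q : node) :
  q != [bseq] -> size (word_parent q) < size q.
Proof. by rewrite word_parentE -val_eqE /=; case: (val q). Qed.

Definition word_tree : sgraph := parent_graph size_word_parent.

(** A letter placed on top of [q] can refer only to these vertices, of which there is at most one
    per color. *)
Definition word_bag (q : word_tree) : {set universal} :=
  [set p : universal | [exists i, look (q : node) i == Some (val (val p))]].

Lemma look_self (q : seq (letter w)) : introducing q -> exists i, look q i = Some q.
Proof. by case: q => // -[//|[c A]] q _; exists c; rewrite /= eqxx. Qed.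

Lemma mem_word_bag_self (p : universal) : p \in word_bag (val p).
Proof.
by have [i pi] := look_self (valP p); rewrite inE; apply/existsP; exists i; apply/eqP.
Qed.

(** The bag of [q] works: the color of [p] differs from the one that [q] introduces, so [p] is still
    the latest of its color there. *)
Lemma word_bag_edge (p q : universal) : back (val p) (val q) ->
  exists t, p \in word_bag t /\ q \in word_bag t.
Proof.
move=> pq; exists (val q); split; last exact: mem_word_bag_self.
rewrite inE; case/existsP: pq => i; case: (val q) => -[//|[//|[c A]] q'] qd /=.
by case/and3P=> ic _ E; apply/existsP; exists i; rewrite /= [c == i]eq_sym (negbTE ic).
Qed.

(** Passing to the tail keeps the latest vertex of a color until the word of that vertex is
    reached. *)
Lemma word_bag_connected (p : universal) :
  connected (induced [set t | p \in word_bag t]).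
Proof.
set S := [set t | p \in word_bag t]; pose G := induced S.
have pS : val p \in S by rewrite inE mem_word_bag_self.
pose p0 : G := exist _ (val p) pS.
have top (t : G) : connect (@adj G) t p0.
  case: t => t; have [n] := ubnP (size (t : node)).
  elim: n t => // n IH t /ltnSE tn tS.
  have [E|tp] := eqVneq t (val p).
    by suff -> : exist _ t tS = p0 by []; apply: val_inj.
  have t0 : t != [bseq].
    apply: contraTneq tS => ->; rewrite !inE; apply/existsP => -[i].
    by rewrite /=.
  have p'S : word_parent t \in S.
    move: tS; rewrite !inE => /existsP[i /eqP E]; apply/existsP; exists i.
    rewrite word_parentE; move: E t0 tp; rewrite -!val_eqE /=.
    case: (val t) => //= -[b|[c A]] t' /=; first by move=> -> _ _.
    by case: eqP => [_ [<-] _ /eqP|_ ->].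
  pose t' : G := exist _ (word_parent t) p'S.
  apply: (@connect_trans _ _ t').
    by apply: connect1; rewrite /= /induced_adj /= /parent_adj t0 eqxx.
  by apply: IH; apply: leq_trans (size_word_parent t0) tn.
move=> x y; apply: connect_trans (top x) _.
by rewrite (@sym_connect_sym _ _ (@adj_sym G)).
Qed.

Definition universal_decomposition : tree_decomposition universal.
Proof.
apply: (@TreeDecomposition _ word_tree word_bag).
- exact: parent_graph_tree.
- by move=> p; exists (val p); apply: mem_word_bag_self.
- move=> p q /orP[/word_bag_edge//|/word_bag_edge[t [qt pt]]].
  by exists t.
- exact: word_bag_connected.
Defined.

Lemma treewidth_universal : treewidth universal <= w.-1.
Proof.
apply: (@treewidth_leq _ universal_decomposition) => q.
apply: leq_trans (leqSpred w); rewrite -[X in _ <= X]card_ord.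
pose f (p : universal) : option (seq (letter w)) := Some (val (val p)).
rewrite -(size_image f) -(size_image (look (q : node))).
apply: uniq_leq_size => [|_ /imageP[p + ->]].
  by rewrite map_inj_uniq ?enum_uniq // => p p' [] /val_inj/val_inj.
by rewrite inE => /existsP[i /eqP E]; apply/imageP; exists i.
Qed.
End UniversalGraph.

(** Padding with [None] up to length [d] turns a word into a function from ['I_d] to [option T]. *)
Lemma card_bseq_leq (T : finType) d : #|{: d.-bseq T}| <= #|T|.+1 ^ d.
Proof.
rewrite -card_option -[X in _ ^ X]card_ord -card_ffun.
pose f (q : d.-bseq T) := [ffun i : 'I_d => onth q i].
apply: (@leq_card _ _ f) => p q /ffunP E; apply: val_inj => /=.
have onth_pq i : onth p i = onth q i.
  have [id|di] := ltnP i d; first by have := E (Ordinal id); rewrite !ffunE.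
  by rewrite !onth_default // (leq_trans (size_bseq _) di).
by apply/eq_from_onth.
Qed.

Lemma card_universal w d : #|universal w d| <= #|letter w|.+1 ^ d.
Proof.
apply: leq_trans (card_bseq_leq _ _).
by rewrite card_sig; apply: max_card.
Qed.

Lemma contains_universal w d (H : sgraph) :
  0 < w -> embeds w d set0 [set: H] -> contains_induced (universal w d) H.
Proof.
case: w => // w _ E.
have [|f [f1 f2 f3 _]] := E (fun=> ord0); first by move=> x; rewrite inE.
have fd v : size (f v) <= d by have /andP[] := f1 v (in_setT v).
have fI v : introducing (Bseq (fd v)) by have /andP[] := f1 v (in_setT v).
pose g v : universal w.+1 d := exist _ (Bseq (fd v)) (fI v).
have g_inj : injective g by move=> u v [] /f2; apply; rewrite inE.
have gS v : g v \in [set g x | x in H] by apply: imset_f.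
exists [set g x | x in H].
pose h v : induced [set g x | x in H] := exist _ (g v) (gS v).
have h_inj : injective h by move=> u v [] /f2; apply; rewrite inE.
have h_adj : {mono h : x y / adj x y}.
  by move=> u v; rewrite [RHS]f3 ?inE.
have h_surj y : exists x, h x == y.
  by have /imsetP[x _ yx] := valP y; exists x; apply/eqP/val_inj.
(* [isomorphic] asks for a map out of the induced subgraph, so [h] has to be inverted. *)
pose k y := xchoose (h_surj y).
have hk : cancel k h by move=> y; apply/eqP/(xchooseP (h_surj y)).
exists k; split; first by exists h => // x; apply: h_inj; rewrite hk.
by move=> x y; rewrite -h_adj !hk.
Qed.

(** * Balanced decomposition along an elimination forest *)

(* [anc u v] means that [u] is an ancestor of [v] or [v] itself, and [bnd v]
   contains all the neighbors of the subtree of [v] outside of it. *)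
Record elimination_forest (H : sgraph) (k : nat) := EliminationForest {
  anc : rel H;
  bnd : H -> {set H};
  anc_refl : reflexive anc;
  anc_anti : antisymmetric anc;
  anc_trans : transitive anc;
  anc_chain : forall x u v, anc u x -> anc v x -> anc u v || anc v u;
  bnd_anc : forall x v, x \in bnd v -> anc x v && (x != v);
  bnd_adj : forall u v, adj u v -> (u \in bnd v) || (v \in bnd u);
  bnd_conv : forall u v x, anc u v -> x \in bnd v -> (x \in bnd u) || anc u x;
  card_bnd : forall v, #|bnd v| <= k }.

Section Balancing.
Variables (H : sgraph) (k : nat) (F : elimination_forest H k).
Hypothesis k_gt0 : 0 < k.
Local Notation w := (3 * k).
Local Notation le := (anc F).
Local Notation B := (bnd F).
Implicit Types (Z V S : {set H}) (a b f g u v x : H).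

Definition desc v : {set H} := [set x | le v x].

Definition down_closed V := [forall v in V, desc v \subset V].

Definition is_root V a := (a \in V) && [forall u in V, le u a ==> (u == a)].

Lemma down_closedP V :
  reflect (forall v x, v \in V -> le v x -> x \in V) (down_closed V).
Proof.
apply: (iffP forall_inP) => VD v => [x vV vx|vV].
  by apply: (subsetP (VD v vV)); rewrite inE.
by apply/subsetP => x; rewrite inE; apply: VD.
Qed.

Lemma desc_closed v : down_closed (desc v).
Proof. by apply/down_closedP => u x; rewrite !inE; apply: anc_trans. Qed.

Lemma mem_desc v : v \in desc v.
Proof. by rewrite inE; apply: anc_refl. Qed.

Lemma le_desc u v : le u v -> desc v \subset desc u.
Proof. by move=> uv; apply/subsetP => x; rewrite !inE; apply: anc_trans. Qed.

Lemma bnd_desc x v : x \in B v -> x \notin desc v.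
Proof.
move=> /bnd_anc/andP[xv xv']; rewrite inE; apply: contraNN xv' => vx.
by apply/eqP/(@anc_anti _ _ F); rewrite xv.
Qed.

(** One end of an edge lies in the boundary of the other. If [u] is in [bnd v], then [bnd_conv] puts
    it in [bnd f] or below [f]; otherwise [v] is an ancestor of [u], and [u] is below [f]. *)
Lemma no_adj f u v : u \notin desc f -> u \notin B f -> v \in desc f -> ~~ adj u v.
Proof.
move=> uf uB; rewrite inE => fv; apply/negP => /(bnd_adj F)/orP[uv|/bnd_anc/andP[vu _]].
  by case/orP: (bnd_conv fv uv) => [uB'|fu]; [case/negP: uB|case/negP: uf; rewrite inE].
by case/negP: uf; rewrite inE; apply: anc_trans vu.
Qed.

Lemma exists_root V b : b \in V -> exists a, is_root V a && le a b.
Proof.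
move=> bV; pose P u := (u \in V) && le u b.
(* The topmost ancestor of [b] inside [V] is found as the one with the largest subtree. *)
have [|a /andP[aV ab] amax] := @arg_maxnP _ b P (fun u => #|desc u|).
  by rewrite /P bV; apply: anc_refl.
exists a; rewrite /is_root aV ab andbT; apply/forall_inP => u uV; apply/implyP => ua.
have /eqP E : desc a == desc u.
  rewrite eqEcard le_desc //=; apply: amax.
  by rewrite /P uV; apply: anc_trans ab.
apply/eqP/(@anc_anti _ _ F); rewrite ua.
by have := mem_desc u; rewrite -E inE.
Qed.

Lemma root_closed V a : down_closed V -> is_root V a -> down_closed (V :\: desc a).
Proof.
move=> /down_closedP VD /andP[aV /forall_inP ra]; apply/down_closedP => v x.
rewrite !inE => /andP[av vV] vx; rewrite (VD v x vV vx) andbT.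
apply: contraNN av => ax; case/orP: (anc_chain ax vx) => // va.
by have /implyP/(_ va)/eqP-> := ra v vV; apply: anc_refl.
Qed.

Lemma root_bnd V a x : is_root V a -> x \in B a -> x \notin V.
Proof.
move=> /andP[aV /forall_inP ra] /bnd_anc/andP[xa xa'].
by apply: contraNN xa' => xV; have /implyP/(_ xa) := ra x xV.
Qed.

(** Adjacent vertices are comparable, so the lower end of an edge is in the same down-closed part as
    the upper end. *)
Lemma embeds_split_closed d Z V V1 : V1 \subset V -> down_closed V1 ->
    down_closed (V :\: V1) ->
  embeds w d Z V1 -> embeds w d Z (V :\: V1) -> embeds w d.+1 Z V.
Proof.
move=> sV /down_closedP c1 /down_closedP c2; apply: embeds_split => // u v u1 v2.
apply/negP => /(bnd_adj F)/orP[/bnd_anc/andP[uv _]|/bnd_anc/andP[vu _]].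
  by move: v2; rewrite inE (c1 _ _ u1 uv).
by have := c2 _ _ v2 vu; rewrite inE u1.
Qed.

Lemma embeds_card1 Z V : #|V| <= 1 -> #|Z| <= 2 * k -> [disjoint Z & V] ->
  embeds w 1 Z V.
Proof.
move=> V1 Zk ZV; have [->|[v vV]] := set_0Vmem V.
  exact: embeds0.
have EV : V = [set v].
  by apply/esym/eqP; rewrite eqEcard sub1set vV cards1.
apply: (@embeds_intro1 _ _ _ _ _ v) => //; first by rewrite (disjointFl ZV).
  by lia.
by rewrite EV setDv; apply: embeds0.
Qed.

(** The bound [k.+1] leaves room for a vertex [f] with its boundary, which separates what is
    strictly below [f]. *)
Definition forest_at m d := forall Z V, down_closed V ->
  (forall v, v \in V -> B v \subset Z :|: V) -> [disjoint Z & V] ->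
  #|Z| <= k.+1 -> #|V| <= m -> embeds w d Z V.

(* The cut at [bnd f] of an intermediate vertex [f] turns a tube into two tubes,
   both of which keep only two boundaries. *)
Definition tube_at m d := forall a b, le a b ->
  #|desc a :\: desc b| <= m ->
  embeds w d (B a :|: B b) ((desc a :\: desc b) :\: B b).

Lemma forest1 : forest_at 1 1.
Proof. by move=> Z V _ _ ZV Zk V1; apply: embeds_card1 => //; lia. Qed.

Lemma tube_disjoint a b : [disjoint B a :|: B b & (desc a :\: desc b) :\: B b].
Proof.
rewrite -setI_eq0; apply/eqP/setP => x; rewrite in_set0 in_setI in_setU !in_setD.
apply/negP; case/andP=> [/orP[/bnd_desc/negbTE->|->]] //; by rewrite !andbF.
Qed.

Lemma card_setU_leq S1 S2 : #|S1 :|: S2| <= #|S1| + #|S2|.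
Proof. by rewrite cardsU leq_subr. Qed.

Lemma tube1 : tube_at 1 1.
Proof.
move=> a b ab c1; apply: embeds_card1; last exact: tube_disjoint.
  by apply: leq_trans c1; apply: subset_leq_card; apply: subsetDl.
apply: leq_trans (card_setU_leq _ _) _.
by have := card_bnd F a; have := card_bnd F b; lia.
Qed.

(** The members of [bnd v] are ancestors of [v], so one in the down-closed complement would pull [v]
    into it. *)
Lemma bnd_subl Z V V1 : down_closed (V :\: V1) -> V1 \subset V ->
  (forall v, v \in V -> B v \subset Z :|: V) ->
  forall v, v \in V1 -> B v \subset Z :|: V1.
Proof.
move=> /down_closedP c2 sV ZB v v1; apply/subsetP => x xv.
have := subsetP (ZB v (subsetP sV _ v1)) x xv; rewrite !in_setU.
case/orP=> [->|xV] //; apply/orP; right; apply/negPn/negP => x1.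
have /andP[xv' _] := bnd_anc xv.
have /c2/(_ xv') : x \in V :\: V1 by rewrite inE x1.
by rewrite inE v1.
Qed.

Lemma bnd_subD Z V V1 : down_closed V1 ->
  (forall v, v \in V -> B v \subset Z :|: V) ->
  forall v, v \in V :\: V1 -> B v \subset Z :|: (V :\: V1).
Proof.
move=> /down_closedP c1 ZB v; rewrite inE => /andP[v1 vV].
apply/subsetP => x xv; have := subsetP (ZB v vV) x xv.
rewrite !inE => /orP[->|->] //; rewrite andbT orbC; case: (boolP (x \in V1)) => //.
by have /andP[xv' _] := bnd_anc xv; move/c1/(_ xv'); rewrite (negbTE v1).
Qed.

(** Two branchings separate three parts of size at most [m]: a largest admissible union [V1], one
    more subtree that would overflow it, and the rest, which is small because the first two together
    exceed [m]. *)
Lemma forest_small m d Z V : forest_at m d -> down_closed V ->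
  (forall v, v \in V -> B v \subset Z :|: V) -> [disjoint Z & V] ->
  #|Z| <= k.+1 -> #|V| <= 2 * m -> (forall v, v \in V -> #|desc v| <= m) ->
  embeds w d.+2 Z V.
Proof.
move=> Fm cV ZB ZV Zk Vm small.
pose P S := [&& S \subset V, down_closed S, down_closed (V :\: S) & #|S| <= m].
have P0 : P set0.
  by rewrite /P sub0set setD0 cV cards0 andbT; apply/forall_inP => v; rewrite inE.
have [V1 /and4P[sV1 c1 c2 V1m] V1max] := @arg_maxnP _ set0 P (fun S => #|S|) P0.
apply: (embeds_split_closed sV1) => //.
  apply: embeds_leq (leqnSn d) _; apply: Fm => //; first exact: bnd_subl c2 sV1 ZB.
  exact: disjointWr sV1 ZV.
have ZB2 := bnd_subD c1 ZB.
have [->|[v vW]] := set_0Vmem (V :\: V1); first exact: embeds0.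
have [a /andP[ra _]] := exists_root vW.
have /andP[a1 aV] : (a \notin V1) && (a \in V).
  by case/andP: ra; rewrite inE.
have cWa := root_closed c2 ra.
have saW : desc a \subset V :\: V1 by apply: (forall_inP c2); case/andP: ra.
have saV : desc a \subset V by apply: (forall_inP cV).
have sWV : V :\: V1 \subset V by apply: subsetDl.
have big : m < #|V1| + #|desc a|.
  rewrite ltnNge; apply/negP => le_m.
  have : P (V1 :|: desc a).
    rewrite /P subUset sV1 saV -setDDl cWa (leq_trans (card_setU_leq _ _)) // !andbT.
    apply/down_closedP => u x; rewrite !in_setU => /orP[uV|ua] ux.
      by rewrite (down_closedP _ c1 u x).
    by rewrite (down_closedP _ (desc_closed a) u x) ?orbT.
  move/V1max; rewrite /geq /= leqNgt; case/negP; apply: proper_card.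
  apply/properP; split; first exact: subsetUl.
  by exists a; rewrite // in_setU mem_desc orbT.
have card3 : #|(V :\: V1) :\: desc a| <= m.
  have := cardsID V1 V; have := cardsID (desc a) (V :\: V1).
  rewrite (setIidPr saW) (setIidPr sV1); move: big Vm; clear; lia.
have ca := desc_closed a.
apply: (embeds_split_closed saW) => //; apply: Fm => //.
- exact: bnd_subl cWa saW ZB2.
- exact: disjointWr saV ZV.
- exact: small.
- exact: bnd_subD ca ZB2.
- exact: disjointWr (subset_trans (subsetDl _ _) sWV) ZV.
Qed.

Lemma anc_bnd f v x : le f v -> x \in B v -> (x \in B f) || (x \in desc f).
Proof. by move=> fv /(bnd_conv fv); rewrite inE. Qed.

Lemma adj_desc f x v : v \in desc f -> adj x v -> (x \in B f) || (x \in desc f).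
Proof.
move=> vf; apply: contraTT; rewrite negb_or => /andP[xB xf].
exact: no_adj vf.
Qed.

Definition below f : {set H} := desc f :\ f.

Lemma below_closed f : down_closed (below f).
Proof.
apply/down_closedP => v x; rewrite !inE => /andP[vf fv] vx.
rewrite (anc_trans fv vx) andbT; apply: contraNneq vf => xf.
by apply/eqP/(@anc_anti _ _ F); rewrite fv -[X in anc F v X]xf vx.
Qed.

Lemma bnd_below f v : v \in below f -> B v \subset (f |: B f) :|: below f.
Proof.
rewrite !inE => /andP[_ fv]; apply/subsetP => x /(anc_bnd fv).
by rewrite !inE; case: eqP; case: (x \in B f).
Qed.

Lemma below_disjoint f : [disjoint f |: B f & below f].
Proof.
rewrite -setI_eq0; apply/eqP/setP => x; rewrite !inE; apply/negP.
case/andP => /orP[->//|/bnd_desc]; rewrite inE => /negbTE->; by rewrite andbF.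
Qed.

Lemma card_bag f : #|f |: B f| <= k.+1.
Proof.
by rewrite cardsU1 -add1n leq_add ?leq_b1 //; apply: card_bnd.
Qed.

(** If some subtree is large, a branching isolates a tree [desc a] with more than [m] vertices. In
    it [f] is a lowest vertex whose subtree exceeds [m]. Once [f] and [bnd f] are introduced, the
    part below [f] has only small subtrees, and the rest is a tube with fewer than [m] vertices.
    This costs two branchings, at most [k.+1] introductions and the two levels of [forest_small]. *)
Lemma forest_step m d : forest_at m d -> tube_at m d ->
  forest_at (2 * m) (d + k + 5).
Proof.
move=> Fm Tm Z V cV ZB ZV Zk Vm.
have [small|] := boolP [forall v in V, #|desc v| <= m].
  apply: (@embeds_leq _ _ d.+2); first by clear; lia.
  by apply: (forest_small Fm) => // v vV; apply: (forall_inP small).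
rewrite negb_forall => /existsP[v0]; rewrite negb_imply -ltnNge => /andP[v0V v0m].
have [a /andP[ra av]] := exists_root v0V.
have aV : a \in V by case/andP: ra.
have saV : desc a \subset V by apply: (forall_inP cV).
have ca := root_closed cV ra.
rewrite addnS; apply: (embeds_split_closed saV) => //; first exact: desc_closed.
  2: { apply: (@embeds_leq _ _ d); first by clear; lia.
       apply: Fm => //.
       - by apply: bnd_subD => //; apply: desc_closed.
       - exact: disjointWr (subsetDl _ _) ZV.
       - have := cardsID (desc a) V; rewrite (setIidPr saV).
         by have := subset_leq_card (le_desc av); move: v0m Vm; clear; lia. }
(* All of [bnd a] is active because [a] is a root of [V]; no other active vertex has a neighbor in
   [desc a]. *)
apply: (@embeds_mono _ _ _ _ (B a) _ (desc a)) => //.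
- apply/subsetP => x xa; have := subsetP (ZB a aV) x xa.
  by rewrite inE (negbTE (root_bnd ra xa)) orbF.
- move=> x v xZ va /(adj_desc va)/orP[] // xa.
  by have := disjointFr ZV xZ; rewrite (subsetP saV).
have [|f /andP[fa fm] fmin] :=
  @arg_minnP _ a (fun u => (u \in desc a) && (m < #|desc u|)) (fun u => #|desc u|).
  by rewrite mem_desc /=; apply: leq_trans v0m (subset_leq_card (le_desc av)).
have af : le a f by move: fa; rewrite inE.
have sfa : desc f \subset desc a by apply: le_desc.
(* Members of [bnd f] outside [desc a] are already in [bnd a]. *)
pose S := (f |: B f) :&: desc a.
have Sk : #|S| <= k.+1.
  by apply: leq_trans (card_bag f); apply: subset_leq_card; apply: subsetIl.
apply: (@embeds_leq _ _ (d.+3 + #|S|)); first by move: Sk; clear; lia.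
have BaS : B a :|: S = B a :|: (f |: B f).
  apply/setP => x; rewrite !in_setU in_setI in_setU in_set1.
  case: (boolP (x \in B a)) => //= xa; case: eqP => [->|_] /=; first by rewrite fa.
  by case: (boolP (x \in B f)) => //= /(anc_bnd af); rewrite (negbTE xa).
apply: embeds_intro; first exact: subsetIr.
- rewrite -setI_eq0; apply/eqP/setP => x; rewrite in_set0 in_setI; apply/negP.
  by case/andP => /bnd_desc/negP.
- rewrite BaS; apply: leq_trans (card_setU_leq _ _) _.
  by have := card_bag f; have := card_bnd F a; move: k_gt0; clear; lia.
rewrite BaS.
have sV1 : below f \subset desc a :\: S.
  apply/subsetP => x xf; rewrite !inE; move: (xf); rewrite !inE => /andP[xf' fx].
  rewrite (negbTE xf') /= (anc_trans af fx) !andbT.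
  by apply/negP => /bnd_desc; rewrite inE fx.
have outf v : v \in (desc a :\: S) :\: below f -> (v \notin desc f) && (v \notin B f).
  rewrite !inE; case: eqP => [->|_] /=; first by case: (le a f).
  by case: (v \in B f) => //; case: (le a v); rewrite ?andbT ?andbF.
have inf v : v \in below f -> v \in desc f by rewrite !inE => /andP[].
apply: (embeds_split sV1).
- by move=> u v /inf uf /outf/andP[v1 v2]; rewrite adj_sym; apply: no_adj uf.
- apply: (@embeds_mono _ _ _ _ (f |: B f) _ (below f)) => //; first exact: subsetUr.
    move=> x v; rewrite in_setU => /orP[xa|//] /inf vf /(adj_desc vf)/orP[xf|xf].
      by rewrite !inE xf orbT.
    by have := bnd_desc xa; rewrite (subsetP sfa).
  apply: (forest_small Fm) => //.
  + exact: below_closed.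
  + exact: bnd_below.
  + exact: below_disjoint.
  + exact: card_bag.
  + apply: leq_trans Vm; apply: subset_leq_card.
    exact: subset_trans (subsetDl _ _) (subset_trans sfa saV).
  move=> v vf; rewrite leqNgt; apply/negP => vm.
  have := fmin v; rewrite vm (subsetP sfa) ?inf //= => /(_ isT); rewrite leqNgt.
  case/negP; apply: proper_card; apply/properP; split.
    by apply: le_desc; move/inf: vf; rewrite inE.
  exists f; first exact: mem_desc.
  move: vf; rewrite !inE => /andP[vf fv]; apply: contraNN vf => vf.
  by apply/eqP/(@anc_anti _ _ F); rewrite fv vf.
(* Here [f] can be forgotten, since its neighbors outside [desc f] are in [bnd f]. *)
- apply: (@embeds_mono _ _ _ _ (B a :|: B f) _ ((desc a :\: desc f) :\: B f)).
  + by rewrite setUS // subsetUr.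
  + apply/subsetP => v vV; have /andP[v1 v2] := outf v vV.
    rewrite in_setD v2 in_setD v1 /=.
    by move: vV; rewrite in_setD [in X in _ && X]in_setD => /and3P[].
  + move=> x v + /outf/andP[v1 v2] xv; rewrite !in_setU in_set1.
    case/or3P=> [->//|/eqP xf|->]; last by rewrite orbT.
    by case/negP: (no_adj v1 v2 (mem_desc f)); rewrite adj_sym -xf.
  apply: (@embeds_leq _ _ d); first by clear; lia.
  apply: Tm => //; have := cardsID (desc f) (desc a); rewrite (setIidPr sfa).
  by have := subset_leq_card saV; move: fm Vm; clear; lia.
Qed.

(** A lowest [f] between [a] and [b] is taken whose tube down to [b] exceeds [m]. Introducing
    [bnd f] makes three boundaries active at once, whence the [3 * k] colors. The tube from [a] to
    [f] has fewer than [m] vertices. Once [f] is introduced, the one from [f] to [b] falls into a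
    tube from the child [g] of [f] towards [b], small by the choice of [f], and a forest that may
    have up to [2 * m] vertices. *)
Lemma tube_step m d : forest_at (2 * m) d -> tube_at m d ->
  tube_at (2 * m) (d + k + 3).
Proof.
move=> Fm Tm a b ab abm.
have [small|big] := leqP #|desc a :\: desc b| m.
  by apply: (@embeds_leq _ _ d); [clear; lia|apply: Tm].
have [|f /and3P[af fb fm] fmin] := @arg_minnP _ a
  (fun u => [&& le a u, le u b & m < #|desc u :\: desc b|]) (fun u => #|desc u|).
  by rewrite ab big anc_refl.
have sfa := le_desc af; have sbf := le_desc fb.
set Z := B a :|: B b; set V := _ :\: B b.
pose S := B f :&: V.
have Sk : #|S| <= k.
  by apply: leq_trans (card_bnd F f); apply: subset_leq_card; apply: subsetIl.
have ZS : Z :|: S = Z :|: B f.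
  apply/setP => x; rewrite !in_setU in_setI !in_setD.
  case: (boolP (x \in B b)) => [_|xb]; first by rewrite orbT.
  case: (boolP (x \in B f)) => //= xf; rewrite orbF.
  have xf' : x \notin desc b.
    by apply: contraNN (bnd_desc xf); apply: (subsetP sbf).
  by rewrite xf'; case: (boolP (x \in B a)) (anc_bnd af xf) => //= _ ->.
have VS : V :\: S = V :\: B f.
  by rewrite setDIr setDv setU0.
apply: (@embeds_leq _ _ (d.+3 + #|S|)); first by move: Sk; clear; lia.
apply: embeds_intro; [exact: subsetIr|exact: tube_disjoint| |].
  rewrite ZS; apply: leq_trans (card_setU_leq _ _) _.
  have := card_setU_leq (B a) (B b); have := card_bnd F a.
  by have := card_bnd F b; have := card_bnd F f; rewrite -/Z; clear; lia.
rewrite ZS VS.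
pose V1 := (desc f :\: desc b) :\: B b.
have sV1 : V1 \subset V :\: B f.
  apply/subsetP => x; rewrite !in_setD => /and3P[-> -> xf] /=.
  rewrite (subsetP sfa) // andbT; apply/negP => /bnd_desc.
  by rewrite xf.
have outf v : v \in (V :\: B f) :\: V1 -> (v \notin desc f) && (v \notin B f).
  rewrite /V /V1 !in_setD => /andP[+ /and4P[-> nb nd _]]; by rewrite nb nd /= andbT.
have inf v : v \in V1 -> v \in desc f by rewrite !in_setD => /and3P[].
apply: (embeds_split sV1).
- by move=> u v /inf uf /outf/andP[v1 v2]; rewrite adj_sym; apply: no_adj uf.
- apply: (@embeds_mono _ _ _ _ (B f :|: B b) _ V1) => //.
  + by rewrite setUC /Z -setUA subsetUr.
  + move=> x v; rewrite !in_setU => /orP[/orP[xa|->]|->] //; last by rewrite orbT.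
    move=> /inf vf /(adj_desc vf)/orP[->//|xf].
    by have := bnd_desc xa; rewrite (subsetP sfa).
  (* The intersection is empty if [f] is in [bnd b] and hence already active. *)
  pose S1 := [set f] :&: V1.
  have S1k : #|S1| <= 1.
    by rewrite -(cards1 f); apply: subset_leq_card; apply: subsetIl.
  have fb' : f \notin desc b.
    apply/negP => bf; have := fm.
    have -> : desc f :\: desc b = set0; last by rewrite cards0.
    by apply/eqP; rewrite setD_eq0 le_desc //; move: bf; rewrite inE.
  apply: (@embeds_leq _ _ (d.+1 + #|S1|)); first by move: S1k; clear; lia.
  apply: embeds_intro; [exact: subsetIr|exact: tube_disjoint| |].
    apply: leq_trans (card_setU_leq _ _) _.
    have := card_setU_leq (B f) (B b); have := card_bnd F f.
    by have := card_bnd F b; move: k_gt0 S1k; clear; lia.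
  set Z2 := _ :|: S1; set V3 := _ :\: S1.
  have fZ2 : f \in Z2.
    rewrite !in_setU in_setI in_set1 eqxx !in_setD fb' mem_desc /= andbT.
    by case: (f \in B b); rewrite ?orbT.
  have V3P v : v \in V3 -> [&& v \in below f, v \notin desc b & v \notin B b].
    rewrite /V3 in_setD in_setI in_set1 => /andP[+ vV1]; rewrite vV1 andbT => vf.
    by move: vV1; rewrite /V1 !in_setD => /and3P[-> -> ->]; rewrite in_set1 vf.
  have bW : b \in below f.
    rewrite in_setD1 (subsetP sbf) ?mem_desc // andbT.
    by apply: contraNneq fb' => <-; apply: mem_desc.
  have [g /andP[rg gb]] := exists_root bW.
  have gW : g \in below f by case/andP: rg.
  have sgW : desc g \subset below f by apply: (forall_inP (below_closed f)).
  have fg : le f g by move: gW; rewrite !inE => /andP[].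
  have bg x : x \in B g -> x \in f |: B f.
    move=> xg; have := subsetP (bnd_below gW) x xg.
    by rewrite in_setU (negbTE (root_bnd rg xg)) orbF.
  (* A vertex of [bnd b] below [f] is comparable with the root [g], hence in its subtree. The forest
     outside [desc g] can therefore forget it. *)
  have wg x : x \in B b -> x \in below f -> x \in desc g.
    move=> /bnd_anc/andP[xb _] xW; rewrite inE.
    case/orP: (anc_chain gb xb) => // xg.
    by case/andP: rg => _ /forall_inP/(_ x xW)/implyP/(_ xg)/eqP->; apply: anc_refl.
  have Z2P x : x \in Z2 -> [|| x == f, x \in B f | x \in B b].
    rewrite /Z2 !in_setU in_setI in_set1 => /orP[/orP[->|->]|/andP[->]] //;
    by rewrite !orbT.
  have Z2S x : x \in f |: B f -> x \in Z2.
    by rewrite in_setU1 => /orP[/eqP-> //|xf]; rewrite /Z2 !in_setU xf.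
  have ZW x : x \in Z2 -> x \in below f -> x \in B b.
    move=> /Z2P xZ xW; case/or3P: xZ xW => // [/eqP->|/bnd_desc]; rewrite !inE ?eqxx //.
    by move=> /negbTE->; rewrite andbF.
  pose V4 := (desc g :\: desc b) :\: B b.
  have sV4 : V4 \subset V3.
    apply/subsetP => x; rewrite /V3 /V4 /V1 !in_setD in_setI in_set1.
    case/and3P=> -> -> /(subsetP sgW); rewrite in_setD1 => /andP[/negbTE-> ->].
    by [].
  have inW v : v \in V3 :\: V4 -> [&& v \in below f, v \notin desc b & v \notin desc g].
    rewrite in_setD => /andP[+ /V3P/and3P[-> bV bB]].
    by rewrite /V4 !in_setD bB bV.
  have gN x v : x \in desc g -> v \in V3 :\: V4 -> ~~ adj x v.
    move=> xg /inW/and3P[vW _ vg]; rewrite adj_sym; apply: no_adj xg => //.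
    by apply/negP => /(root_bnd rg)/negP.
  apply: (embeds_split sV4).
  - by move=> u v uV; apply: gN; move: uV; rewrite /V4 !in_setD => /and3P[].
  - apply: (@embeds_mono _ _ _ _ (B g :|: B b) _ V4) => //.
    + apply/subsetP => x; rewrite in_setU => /orP[/bg/Z2S//|xb].
      by rewrite /Z2 !in_setU xb orbT.
    + move=> x v xZ vV4 /adj_desc-/(_ g); rewrite in_setU.
      have vg : v \in desc g by move: vV4; rewrite /V4 !in_setD => /and3P[].
      by case/(_ vg)/orP => [->//|/(subsetP sgW)/(ZW _ xZ)->]; rewrite orbT.
    apply: Tm => //; rewrite leqNgt; apply/negP => gm.
    have := fmin g; rewrite (anc_trans af fg) gb gm leqNgt => /(_ isT)/negP; apply.
    apply: proper_card; apply/properP; split; first exact: le_desc.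
    by exists f; rewrite ?mem_desc //; apply/negP => /(subsetP sgW); rewrite !inE eqxx.
  - apply: (@embeds_mono _ _ _ _ (f |: B f) _ (below f :\: desc g)) => //.
    + by apply/subsetP.
    + by apply/subsetP => v /inW/and3P[vW _ vg]; rewrite in_setD vg.
    + move=> x v xZ vV xv; have /and3P[vW _ _] := inW v vV.
      have vf : v \in desc f by move: vW; rewrite in_setD1 => /andP[].
      case/Z2P/or3P: (xZ) => [/eqP->|xf|xb]; rewrite in_setU1 ?eqxx ?xf ?orbT //.
      case/orP: (adj_desc vf xv) => [->|xf]; first by rewrite orbT.
      case: eqP => //= /eqP xf'; have xW : x \in below f by rewrite in_setD1 xf'.
      by case/negP: (gN x v (wg x xb xW) vV).
    apply: Fm.
    + exact: root_closed (below_closed f) rg.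
    + exact: bnd_subD (desc_closed g) (@bnd_below f).
    + exact: disjointWr (subsetDl _ _) (below_disjoint f).
    + exact: card_bag.
    apply: leq_trans (_ : #|desc f :\: desc b| <= _).
      apply: subset_leq_card; apply/subsetP => x; rewrite !in_setD in_set1.
      case/and3P=> xg _ ->; rewrite andbT; apply: contraNN xg.
      by apply: (subsetP (le_desc gb)).
    apply: leq_trans abm; apply: subset_leq_card; exact: setSD.
- apply: (@embeds_mono _ _ _ _ (B a :|: B f) _ ((desc a :\: desc f) :\: B f)).
  + by rewrite /Z setUAC subsetUl.
  + apply/subsetP => v vV; have /andP[v1 v2] := outf v vV.
    rewrite in_setD v2 in_setD v1 /=.
    by move: vV; rewrite !in_setD => /and5P[].
  + move=> x v + /outf/andP[v1 v2] xv; rewrite !in_setU.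
    case/orP=> [/orP[->//|xb]|->]; last by rewrite orbT.
    case/orP: (anc_bnd fb xb) => [->|xf]; first by rewrite orbT.
    by case/negP: (no_adj v1 v2 xf); rewrite adj_sym.
  apply: (@embeds_leq _ _ d); first by clear; lia.
  apply: Tm => //; have := cardsID (desc f) (desc a :\: desc b).
  have -> : (desc a :\: desc b) :&: desc f = desc f :\: desc b.
    by rewrite setIDAC (setIidPr sfa).
  have -> : (desc a :\: desc b) :\: desc f = desc a :\: desc f.
    by rewrite setDDl (setUidPr sbf).
  by move: fm abm; clear; lia.
Qed.

(** Each doubling takes the forest step first, because the tube step relies on forests of the
    doubled size; together they add [(k + 5) + (k + 3)] to the depth. *)
Lemma forest_tube_exp j :
  forest_at (2 ^ j) ((2 * k + 8) * j + 1) /\ tube_at (2 ^ j) ((2 * k + 8) * j + 1).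
Proof.
elim: j => [|j [Fj Tj]]; first by rewrite muln0; split; [apply: forest1|apply: tube1].
rewrite expnS; have Fj' := forest_step Fj Tj.
have up d d' m : d <= d' -> forest_at m d -> forest_at m d'.
  by move=> dd' Fm Z V *; apply: embeds_leq dd' _; apply: Fm.
split; first by apply: up Fj'; lia.
move=> a b ab abm.
apply: embeds_leq (_ : (2 * k + 8) * j + 1 + k + 5 + k + 3 <= _) _; first lia.
apply: (@tube_step (2 ^ j)) => // {ab abm} {}a {}b ab abm.
by apply: embeds_leq (Tj _ _ ab abm); lia.
Qed.

Lemma embeds_log j : #|H| <= 2 ^ j -> embeds w ((2 * k + 8) * j + 1) set0 [set: H].
Proof.
move=> Hj; case: (forest_tube_exp j) => Fj _; apply: Fj.
- by apply/down_closedP => v x; rewrite inE.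
- by move=> v _; rewrite set0U subsetT.
- by rewrite -setI_eq0 set0I.
- by rewrite cards0.
- by rewrite cardsT.
Qed.

End Balancing.

(** * Elimination forests from tree decompositions *)

Lemma connect_exit (T : finType) (e : rel T) (P : pred T) x y :
  connect e x y -> P x -> ~~ P y -> exists u v, [/\ P u, ~~ P v & e u v].
Proof.
case/connectP=> p; elim: p x => [|z p IH] x /=; first by move=> _ -> ->.
case/andP=> xz zp yE Px nPy; have [Pz|nPz] := boolP (P z); first exact: IH zp yE Pz nPy.
by exists x, z.
Qed.

(* The ancestors of [t] in the tree [T] rooted at [r] are its dominators: the
   vertices that lie on all paths from [r] to [t].  This makes the order and
   convexity properties available without choosing paths. *)
Section Dominance.
Variables (T : sgraph) (r : T).
Hypothesis T_tree : is_tree T.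
Implicit Types (a b c s t x y : T).

Definition avoid s : rel T := fun x y => [&& adj x y, x != s & y != s].

Definition reach s t := (t != s) && (r != s) && connect (avoid s) r t.

Definition dom s t := ~~ reach s t.

Lemma T_connected x y : connect (@adj T) x y.
Proof. by case: T_tree. Qed.

Lemma reach_neq s t : reach s t -> (t != s) && (r != s).
Proof. by case/andP. Qed.

Lemma reach_step s x y : reach s x -> adj x y -> y != s -> reach s y.
Proof.
case/andP=> /andP[xs rs] c xy ys; rewrite /reach ys rs /=.
by apply: connect_trans c (connect1 _); rewrite /avoid xy xs.
Qed.

Lemma reach0 s : r != s -> reach s r.
Proof. by move=> rs; rewrite /reach rs connect0. Qed.

Lemma reach_ind s (P : pred T) t : reach s t -> P r ->
  (forall x y, reach s x -> P x -> adj x y -> y != s -> P y) -> P t.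
Proof.
case/andP=> /andP[ts rs] c Pr step; apply/negPn/negP => nPt.
have Rr := reach0 rs.
have := @connect_exit _ (avoid s) (fun x => P x && reach s x) _ _ c.
rewrite Pr Rr (negbTE nPt) => /(_ isT isT)[u [v [/andP[Pu Ru]]]].
move=> nv /and3P[uv us vs]; case/negP: nv.
by rewrite (step u v) //= (reach_step Ru).
Qed.

Lemma dom_refl : reflexive dom.
Proof. by move=> s; rewrite /dom /reach eqxx. Qed.

(** A walk from [r] to [a] leaves the set of vertices reachable both without [a] and without [b] by
    entering [a] or [b], which is then reached without the other. *)
Lemma dom_anti : antisymmetric dom.
Proof.
move=> a b /andP[ab ba]; apply/eqP/negPn/negP => nab.
have ra : r != a by apply: contraNneq ba => ra; rewrite -ra in nab *; apply: reach0.
have rb : r != b.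
  by apply: contraNneq ab => rb; rewrite -rb eq_sym in nab *; apply: reach0.
have [||u [v [/andP[ua ub] nv uv]]] :=
  @connect_exit _ _ (fun x => reach a x && reach b x) _ _ (T_connected r a) _ _.
- by rewrite !reach0.
- by rewrite {1}/reach eqxx.
case/negP: nv; have [va|va] := eqVneq v a.
  by case/negP: ba; rewrite -va; apply: reach_step ub uv _; rewrite va.
have [vb|vb] := eqVneq v b; last by rewrite (reach_step ua uv va) (reach_step ub uv vb).
by case/negP: ab; rewrite -vb; apply: reach_step ua uv va.
Qed.

Lemma dom_trans : transitive dom.
Proof.
move=> b a c ab bc; apply/negP => ac; case/negP: bc.
have /andP[_ ra] := reach_neq ac.
apply: (reach_ind ac) => [|x y xa xb xy ya].
  by apply: reach0; apply: contraNneq ab => <-; apply: reach0.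
apply: (reach_step xb xy); apply/negP => /eqP yb; case/negP: ab.
by rewrite -yb; apply: reach_step xa xy ya.
Qed.

(** A walk from [c] to [r] can leave the set of vertices dominated by both only from [a] or [b],
    which is then dominated by the other. *)
Lemma dom_chain c a b : dom a c -> dom b c -> dom a b || dom b a.
Proof.
move=> ac bc; apply/negPn; rewrite negb_or !negbK; apply/negP => /andP[ab ba].
have /andP[_ ra] := reach_neq ab; have /andP[_ rb] := reach_neq ba.
have [||u [v [/andP[ua ub] nv uv]]] :=
  @connect_exit _ _ (fun x => dom a x && dom b x) _ _ (T_connected c r).
- by rewrite ac bc.
- by rewrite /dom reach0.
move: nv; rewrite negb_and !negbK; rewrite adj_sym in uv; case/orP=> [va|vb].
  have [E|na] := eqVneq u a; first by case/negP: ub; rewrite E.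
  by case/negP: ua; apply: reach_step va uv na.
have [E|nb] := eqVneq u b; first by case/negP: ua; rewrite E.
by case/negP: ub; apply: reach_step vb uv nb.
Qed.

Lemma avoid_sym s : symmetric (avoid s).
Proof. by move=> x y; rewrite /avoid adj_sym [(x != s) && _]andbC. Qed.

(** This is where acyclicity enters: a path from [p] to [p'] that avoids [t] would close a cycle
    through [t]. So [t] has at most one neighbor on the side of [r]. *)
Lemma reach_adj_unique t p p' :
  adj t p -> adj t p' -> reach t p -> reach t p' -> p = p'.
Proof.
move=> tp tp' /andP[/andP[pt _] rp] /andP[_ rp'].
have : connect (avoid t) p p'.
  by apply: connect_trans rp'; rewrite (sym_connect_sym (@avoid_sym t)).
case/connectP=> q0 /shortenP[q qp qU _] p'E {q0}.
have tq : t \notin p :: q.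
  rewrite in_cons negb_or eq_sym pt /=.
  elim: q p {pt rp tp qU p'E} qp => //= z q IH p /andP[/and3P[_ _ zt] /IH].
  by rewrite in_cons negb_or eq_sym zt.
have cyc : ucycle (@adj T) [:: t, p & q].
  rewrite /ucycle cons_uniq tq qU andbT /= tp rcons_path -p'E adj_sym tp'.
  by rewrite !andbT; apply: (sub_path _ qp) => x y /and3P[].
case: T_tree => _ _ /(_ _ cyc); case: q p'E {qp qU tq cyc} => //= ->.
Qed.

Section ConnectedSet.
Variable S : {set T}.
Hypothesis S_connected : connected (induced S).

(** Take [t] in [S] with fewest dominators. If it fails to dominate [S], a walk inside [S] steps
    from [t] to its neighbor [v] towards [r], which dominates [t] and has fewer dominators. *)
Lemma dom_top s0 : s0 \in S -> exists2 t, t \in S & forall s, s \in S -> dom t s.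
Proof.
move=> s0S.
have [t tS tmin] :=
  @arg_minnP _ s0 (fun t => t \in S) (fun t => #|[set x | dom x t]|) s0S.
exists t => // s sS; apply/negP => ts.
have [||[u uS] [[v vS] [/= tu + uv]]] :=
  @connect_exit _ _ (fun x : induced S => dom t (val x)) _ _
  (S_connected (exist _ t tS) (exist _ s sS)).
- exact: dom_refl.
- by rewrite negbK.
rewrite negbK => tv; rewrite /induced_adj /= in uv.
have ut : u = t.
  apply/eqP/negPn/negP => nut; case/negP: tu.
  by apply: reach_step tv _ nut; rewrite adj_sym.
rewrite {u uS tu}ut in uv.
have /andP[nvt rt] := reach_neq tv.
have vt : dom v t.
  apply/negP => vt; have : reach t t; last by rewrite /reach eqxx.
  apply: (reach_ind vt) => [|x y vx tx xy yv]; first exact: reach0.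
  apply: (reach_step tx xy); apply/eqP => yt; move: (reach_neq vx).
  by rewrite yt adj_sym in xy; rewrite (reach_adj_unique xy uv tx tv) eqxx.
have := tmin v vS; rewrite leqNgt; case/negP; apply: proper_card.
apply/properP; split.
  by apply/subsetP => x; rewrite !inE => xv; apply: dom_trans xv vt.
by exists t; rewrite inE ?dom_refl // /dom negbK.
Qed.

(** If [b] were outside [S], then [a] would be reached without [b], and so would [c], by a walk
    inside [S]. *)
Lemma dom_convex a b c : a \in S -> c \in S -> dom a b -> dom b c -> b \in S.
Proof.
move=> aS cS ab bc; apply/negPn/negP => bS.
have ba : reach b a.
  apply/negPn/negP => ba; case/negP: bS.
  by rewrite -(@dom_anti a b) // ab.
have [|u [v [bu /negP nv uv]]] :=
  @connect_exit _ _ (fun x : induced S => reach b (val x)) _ _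
  (S_connected (exist _ a aS) (exist _ c cS)) ba; first exact: bc.
by apply: nv; apply: reach_step bu uv _; apply: contraNneq bS => <-; apply: valP v.
Qed.

End ConnectedSet.
End Dominance.

(** * Ordering the vertices by their topmost bags *)

Section FromTreeDecomposition.
Variables (H : sgraph) (k : nat) (D : tree_decomposition H).
Hypothesis width_leq : width D <= k.
Implicit Types (u v x : H).
Let T := td_tree D.
Let T_tree : is_tree T := td_treeP D.
Variable r : T.

Lemma card_bag_leq (t : T) : #|td_bag t| <= k.+1.
Proof.
have := @leq_bigmax _ (fun t : T => #|td_bag t|) t.
by move: width_leq; rewrite /width -/T; lia.
Qed.

Lemma exists_top v :
  exists t : T, (v \in td_bag t) && [forall s, (v \in td_bag s) ==> dom r t s].
Proof.
have [s0 vs0] := td_vertexP D v.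
have [|t tS td] := @dom_top _ r T_tree _ (@td_connectedP _ D v) s0.
  by rewrite inE.
exists t; move: tS; rewrite inE => ->; apply/forall_inP => s vs.
by apply: td; rewrite inE.
Qed.

Definition top v : T := xchoose (exists_top v).

Lemma top_bag v : v \in td_bag (top v).
Proof. by case/andP: (xchooseP (exists_top v)). Qed.

Lemma dom_topP v s : v \in td_bag s -> dom r (top v) s.
Proof. by case/andP: (xchooseP (exists_top v)) => _ /forall_inP/(_ s). Qed.

Lemma bag_convex v (a b c : T) : v \in td_bag a -> v \in td_bag c ->
  dom r a b -> dom r b c -> v \in td_bag b.
Proof.
move=> va vc ab bc.
have := @dom_convex _ r T_tree _ (@td_connectedP _ D v) a b c.
by rewrite !inE; apply.
Qed.

(** Vertices with the same topmost bag form a chain, ordered by [enum_rank]. *)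
Definition top_anc : rel H := fun u v =>
  dom r (top u) (top v) && ((top u == top v) ==> (enum_rank u <= enum_rank v)).

Definition top_bnd v : {set H} :=
  [set x | [&& x != v, top_anc x v & x \in td_bag (top v)]].

Lemma top_anc_refl : reflexive top_anc.
Proof. by move=> v; rewrite /top_anc dom_refl leqnn implybT. Qed.

Lemma top_anc_anti : antisymmetric top_anc.
Proof.
move=> u v /andP[/andP[uv ruv] /andP[vu rvu]].
have E : top u = top v by apply: (dom_anti T_tree (r := r)); rewrite uv.
apply/enum_rank_inj/val_inj/anti_leq => /=.
by move: ruv rvu; rewrite E eqxx /= => -> ->.
Qed.

Lemma top_anc_trans : transitive top_anc.
Proof.
move=> v u x /andP[uv ruv] /andP[vx rvx]; rewrite /top_anc.
rewrite (dom_trans uv vx); apply/implyP => /eqP E.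
have E' : top u = top v by apply: (dom_anti T_tree (r := r)); rewrite uv E.
by move: ruv rvx; rewrite -E E' eqxx /=; apply: leq_trans.
Qed.

Lemma top_anc_chain s u v : dom r (top u) s -> dom r (top v) s ->
  top_anc u v || top_anc v u.
Proof.
move=> us vs; rewrite /top_anc [top v == _]eq_sym.
have [E|_] /= := eqVneq (top u) (top v); last by rewrite !andbT (dom_chain T_tree us vs).
by rewrite E dom_refl leq_total.
Qed.

Definition elimination_forest_of_tree_decomposition : elimination_forest H k.
Proof.
apply: (@EliminationForest H k top_anc top_bnd).
- exact: top_anc_refl.
- exact: top_anc_anti.
- exact: top_anc_trans.
- by move=> x u v /andP[ux _] /andP[vx _]; apply: top_anc_chain ux vx.
- by move=> x v; rewrite inE => /and3P[-> ->].
(* Both topmost bags dominate a common bag [s], so the ends are comparable; by convexity the upper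
   end is in the topmost bag of the lower one. *)
- move=> u v uv; have [s [us vs]] := td_edgeP D uv.
  have nuv : u != v by apply: contraTneq uv => ->; rewrite adj_irrefl.
  have [du dv] := (dom_topP us, dom_topP vs).
  case/orP: (top_anc_chain du dv) => le_uv; apply/orP; [left|right]; rewrite inE le_uv.
    by rewrite nuv (bag_convex (top_bag u) us _ dv) //; case/andP: le_uv.
  by rewrite eq_sym nuv (bag_convex (top_bag v) vs _ du) //; case/andP: le_uv.
- move=> u v x /andP[uv ruv]; rewrite !inE => /and3P[_ /andP[xv _] xB].
  have [->|xu] := eqVneq x u; first by rewrite top_anc_refl.
  case/orP: (top_anc_chain xv uv) => [xu'|->]; last by rewrite orbT.
  by rewrite xu' (bag_convex (top_bag x) xB _ uv) //; case/andP: xu'.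
- move=> v; have := card_bag_leq (top v); rewrite (cardsD1 v) top_bag add1n ltnS.
  apply: leq_trans; apply: subset_leq_card; apply/subsetP => x.
  by rewrite !inE => /and3P[-> _ ->].
Defined.

End FromTreeDecomposition.

Lemma elimination_forest_exists (H : sgraph) k :
  treewidth H <= k -> inhabited (elimination_forest H k).
Proof.
rewrite /treewidth; case: ex_minnP => _ /asboolP[D <-] _ Dk.
have [/card_gt0P[r _] _ _] := td_treeP D.
by constructor; apply: (elimination_forest_of_tree_decomposition Dk r).
Qed.

Theorem theorem3p8 (k : nat) (hk : 1 <= k) :
  exists (c : nat) (U : nat -> sgraph),
    forall n : nat, 2 <= n ->
      [/\ treewidth (U n) <= 3 * k - 1,
          #|U n| <= n ^ c
        & forall H : sgraph, #|H| = n -> treewidth H <= k ->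
            contains_induced (U n) H].
Proof.
pose w := 3 * k; pose e := 2 * k + 8; pose L := #|letter w|.+1.
pose d n := e * up_log 2 n + 1.
(* There are at most [L ^ d n <= 2 ^ (L * d n)] vertices, which is bounded by
   [n ^ (L * (2 * e + 1))], and [2 * e + 1 <= 3 * e]. *)
exists (L * (3 * e)), (fun n => universal w (d n)) => n n2.
split; first by rewrite subn1; apply: treewidth_universal.
- apply: leq_trans (card_universal _ _) _; rewrite -/L.
  have d_gt0 : 0 < d n by rewrite /d addn1.
  have LL : L <= 2 ^ L by rewrite ltnW // ltn_expl.
  have un := up_log_gtn (isT : 1 < 2) n2.
  apply: (@leq_trans ((2 ^ L) ^ d n)); first by rewrite leq_exp2r.
  have u_gt0 : 0 < up_log 2 n by rewrite up_log_gt0.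
  (* [2 ^ up_log 2 n] may exceed [n], but the predecessor of this exponent gives a power below [n];
     the remaining factor is absorbed using [2 <= n]. *)
  have dE : d n = (up_log 2 n).-1 * e + (e + 1).
    by rewrite /d -{1}(prednK u_gt0) mulnS; clear; lia.
  rewrite -expnM [L * d n]mulnC dE mulnDl expnD -mulnA expnM.
  apply: (@leq_trans (n ^ (e * L) * n ^ ((e + 1) * L))).
    by rewrite leq_mul // ?leq_exp2r ?(ltnW un) // ?muln_gt0 ?addn_gt0 ?orbT.
  rewrite -expnD leq_pexp2l ?(ltnW n2) // -mulnDl mulnC leq_mul2l.
  by rewrite /e; clear; lia.
move=> H Hn /elimination_forest_exists[F].
apply: contains_universal; first by rewrite /w; move: hk; clear; lia.
by apply: (embeds_log F hk); rewrite Hn; apply: up_logP.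
Qed.
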